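(* Let $\gamma:\widehat{G}\to(0,\infty)$ be a measurable function, and let $\mathscr{L}_0$ be the map with domain $D(\mathscr{L}_0)=\mathfrak{H}^2_\gamma(G,H)$ and values in $S_2(H)$ defined by $\mathscr{L}_0T=\mathcal{F}_U^{-1}\left[(1+\gamma(\cdot)^2)\,\mathcal{F}_U(T)\right]$. If $S\in S_2(H)$, then the quantum Poisson-type equation $\mathscr{L}_0T=S$ has a unique solution $T_0$ in $D(\mathscr{L}_0)$. Moreover, $$\|T_0\|_{\mathfrak{H}^2_\gamma(G,H)}=\|S\|_{S_2(H)}.$$
   Context: Setting. $G$ is a locally compact abelian Hausdorff group with neutral element $e$ and Pontryagin dual $\widehat{G}$; $H$ is a separable complex Hilbert space. $U:G\to U(H)$, $x\mapsto U_x$, is a (strongly continuous) irreducible unitary projective representation of $G$ on $H$: $U_xU_y=m(x,y)U_{xy}$ for all $x,y\in G$, with multiplier $m:G\times G\to\mathbb{T}$ (the unit circle), and $U_e=I$. Put $\sigma(x,y)=m(x,y)/m(y,x)$, so that $U_xU_y=\sigma(x,y)U_yU_x$. It is assumed that: $m$ is a Heisenberg multiplier, i.e. $x\mapsto\sigma(x,\cdot)$ is a topological isomorphism from $G$ onto $\widehat{G}$; $m(x,y)=m(x^{-1},y^{-1})$ for all $x,y\in G$; $U$ is square integrable, i.e. there are non-zero $\phi,\psi\in H$ with $x\mapsto\langle U_x\phi,\psi\rangle$ in $L^2(G)$; and $U$ is integrable, i.e. there is a non-zero $\psi\in H$ with $x\mapsto\langle U_x\psi,\psi\rangle$ in $L^1(G)$.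 One identifies $\widehat{G}$ with $G$ through $\sigma$: for $\xi=\sigma(x,\cdot)\in\widehat{G}$ one writes $U_\xi:=U_x$. Schatten classes. For $1\le p<\infty$, $S_p(H)$ is the space of compact operators on $H$ whose singular values are $p$-summable, with norm $\|T\|_{S_p(H)}$ equal to the $\ell^p$ norm of the singular values. $S_1(H)$ is the trace class and $S_2(H)$ the Hilbert-Schmidt class. Quantum Fourier transform. For $T\in S_1(H)$, $\mathcal{F}_U(T)(\xi)=\mathrm{tr}(TU_\xi^* )$, $\xi\in\widehat{G}$. The Haar measure $d\xi$ on $\widehat{G}$ is normalized so that the (known) Plancherel theorem holds: $\mathcal{F}_U$ extends (uniquely) from $S_1(H)$ to a unitary operator $\mathcal{F}_U:S_2(H)\to L^2(\widehat{G})$. This extension defines $\mathcal{F}_U$ on $S_2(H)$, and $\mathcal{F}_U^{-1}:L^2(\widehat{G})\to S_2(H)$ denotes its inverse (equal to its adjoint). Quantum Sobolev space of order 2. $$\mathfrak{H}^2_\gamma(G,H)=\left\{T\in S_2(H) : \int_{\widehat{G}}(1+\gamma(\xi)^2)^2|\mathcal{F}_U(T)(\xi)|^2\,d\xi<\infty\right\},\quad \|T\|_{\mathfrak{H}^2_\gamma(G,H)}=\left(\int_{\widehat{G}}(1+\gamma(\xi)^2)^2|\mathcal{F}_U(T)(\xi)|^2\,d\xi\right)^{1/2}.$$ *)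

(* Defs.v *)
From HB Require Import structures.
From mathcomp Require Import all_boot all_order all_algebra.
From mathcomp Require Import all_classical all_reals all_analysis.
From mathcomp Require Import showcase.summability.
From mathcomp Require Import complex.

Set Implicit Arguments.
Unset Strict Implicit.
Unset Printing Implicit Defensive.

Import Order.TTheory GRing.Theory Num.Theory.
Import numFieldNormedType.Exports.

Local Open Scope classical_set_scope.
Local Open Scope ring_scope.

(* Locally compact abelian groups are written additively: x + y, - x and 0
   stand for xy, x^-1 and e.  The field of complex numbers is R[i]; its
   topology is carried by the alias R[i]^o. *)

Section Dual.
Variables (R : realType) (G : topologicalZmodType).

Record is_character (chi : G -> R[i]) : Prop := IsCharacter {
  character_continuous : continuous (chi : G -> R[i]^o);
  character_norm1 : forall x, `|chi x| = 1;
  character_add : forall x y, chi (x + y) = chi x * chi y }.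

Definition characters : set {compact-open, G -> R[i]^o} :=
  [set chi | is_character chi].

(* A subset used as a type gets the initial topology of the inclusion. *)
Definition dual : Type := characters.

HB.instance Definition _ := Topological.on dual.

Definition dual_fun (xi : dual) : G -> R[i] := set_val xi.

Lemma dual_funP (xi : dual) : is_character (dual_fun xi).
Proof. exact: set_valP. Qed.

Definition to_dual (chi : G -> R[i]) (h : is_character chi) : dual :=
  exist _ (chi : {compact-open, G -> R[i]^o}) (mem_set h).

Lemma dual_inj (xi eta : dual) : dual_fun xi = dual_fun eta -> xi = eta.
Proof. by move=> h; apply/val_inj. Qed.

Lemma is_character1 : is_character (fun=> 1).
Proof.
split=> [|x|x y]; [exact: cst_continuous|exact: normr1|by rewrite mulr1].
Qed.

Lemma is_characterM (chi eta : G -> R[i]) :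
  is_character chi -> is_character eta -> is_character (fun x => chi x * eta x).
Proof.
case=> cc cn cD [ec en eD]; split=> [x|x|x y].
- exact: (@cvgM R[i] _ (nbhs x) _ _ _ _ _ (cc x) (ec x)).
- by rewrite normrM cn en mulr1.
- by rewrite cD eD mulrACA.
Qed.

Lemma is_characterV (chi : G -> R[i]) :
  is_character chi -> is_character (fun x => (chi x)^-1).
Proof.
case=> cc cn cD; split=> [x|x|x y].
- apply: (@cvgV R[i] _ (nbhs x) _ _ _ _ (cc x)).
  by rewrite -normr_eq0 cn oner_eq0.
- by rewrite normfV cn invr1.
- by rewrite cD invfM.
Qed.

Definition dual_zero : dual := to_dual is_character1.
(* The group law of the dual is pointwise multiplication, written additively. *)
Definition dual_add (xi eta : dual) : dual :=
  to_dual (is_characterM (dual_funP xi) (dual_funP eta)).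
Definition dual_opp (xi : dual) : dual := to_dual (is_characterV (dual_funP xi)).

Lemma dual_addA : associative dual_add.
Proof. by move=> x y z; apply/dual_inj/funext => t; exact: mulrA. Qed.

Lemma dual_addC : commutative dual_add.
Proof. by move=> x y; apply/dual_inj/funext => t; exact: mulrC. Qed.

Lemma dual_add0 : left_id dual_zero dual_add.
Proof. by move=> x; apply/dual_inj/funext => t; exact: mul1r. Qed.

Lemma dual_addN : left_inverse dual_zero dual_opp dual_add.
Proof.
move=> x; apply/dual_inj/funext => t; apply: mulVf.
by rewrite -normr_eq0 (character_norm1 (dual_funP x)) oner_eq0.
Qed.

HB.instance Definition _ :=
  GRing.isZmodule.Build dual dual_addA dual_addC dual_add0 dual_addN.

End Dual.

Coercion dual_fun : dual >-> Funclass.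

Record is_top_iso (A B : PreTopologicalZmodule.type) (f : A -> B) : Prop :=
  IsTopIso {
    top_iso_add : {morph f : x y / x + y};
    top_iso_bij : set_bij setT setT f;
    top_iso_continuous : continuous f;
    top_iso_open : forall O, open O -> open (f @` O) }.

Section Borel.
Variable X : PreTopologicalZmodule.type.

Definition borelType : Type := X.

HB.instance Definition _ := Topological.on borelType.
HB.instance Definition _ := GRing.Zmodule.on borelType.
HB.instance Definition _ := isPointed.Build borelType 0.
HB.instance Definition _ := Measurable.copy borelType
  (g_sigma_algebraType (@open borelType)).

End Borel.

(* Haar measures are Radon measures: locally finite, outer regular on Borel
   sets and inner regular on open sets. *)
Record is_haar (R : realType) (X : PreTopologicalZmodule.type)
    (mu : {measure set (borelType X) -> \bar R}) : Prop := IsHaar {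
  haar_neq0 : mu setT != 0%E;
  haar_translation : forall (a : X) (A : set (borelType X)), measurable A ->
    mu [set a + x | x in A] = mu A;
  haar_compact : forall K : set X, compact K -> (mu K < +oo)%E;
  haar_outer : forall A : set (borelType X), measurable A ->
    mu A = ereal_inf [set mu V | V in [set V : set X | open V /\ A `<=` V]];
  haar_inner : forall V : set X, open V ->
    mu V = ereal_sup [set mu K | K in [set K : set X | compact K /\ K `<=` V]] }.

Section ComplexL.
Variables (R : realType) (d : measure_display) (X : measurableType d).
Variable mu : {measure set X -> \bar R}.
Implicit Types f : X -> R[i].

Definition measurable_cfun f :=
  measurable_fun setT (@complex.Re R \o f) /\ measurable_fun setT (@complex.Im R \o f).

Definition cL1 : set (X -> R[i]) := [set f | measurable_cfun f /\
  (\int[mu]_x (Normc.normc (f x))%:E < +oo)%E].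

Definition cL2 : set (X -> R[i]) := [set f | measurable_cfun f /\
  (\int[mu]_x (Normc.normc (f x) ^+ 2)%:E < +oo)%E].

Definition cL2norm f : R :=
  Num.sqrt (fine (\int[mu]_x (Normc.normc (f x) ^+ 2)%:E)%E).

Definition ae_eq_fun f g := {ae mu, forall x, f x = g x}.

End ComplexL.

(* A complex Hilbert space is a complete normed module over R[i] together with
   a dot product inducing its norm.  Dot products are linear on the left and
   antilinear on the right. *)

Definition hilbert_norm (R : realType) (H : completeNormedModType R[i])
  (dp : {dot H for @Num.conj R[i]}) := forall v, dp v v = `|v| ^+ 2.

Definition separable (X : topologicalType) :=
  exists D : set X, countable D /\ dense D.

Section Operators.
Variables (R : realType) (H : completeNormedModType R[i]) (dp : {dot H for @Num.conj R[i]}).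
Implicit Types (A T : H -> H) (V E : set H).

Definition adjoint A : H -> H :=
  get [set B : H -> H | forall v w, dp (A v) w = dp v (B w)].

Record is_unitary A : Prop := IsUnitary {
  unitary_linear : linear A;
  unitary_dot : forall v w, dp (A v) (A w) = dp v w;
  unitary_surj : range A = setT }.

Definition compact_operator T :=
  linear T /\ compact (closure (T @` [set v | `|v| <= 1])).

(* The dimension, in [0, +oo], of the eigenspace of A for the eigenvalue l:
   the supremum of the sizes of its linearly independent families. *)
Definition eigen_mult A (l : R[i]) : \bar R :=
  ereal_sup [set (n%:R)%:E | n in [set n : nat | exists v : 'I_n -> H,
    (forall i, A (v i) = l *: v i) /\
    (forall c : 'I_n -> R[i], \sum_i c i *: v i = 0 -> forall i, c i = 0)]].

(* The (nonzero) singular values of T are the s > 0 such that s ^ 2 is an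
   eigenvalue of T^* T, repeated according to the multiplicity of s ^ 2.  This
   is the sum of their p-th powers. *)
Definition singular_sum (p : R) T : \bar R :=
  (\esum_(s in [set s : R | (0 < s)%R])
    (eigen_mult (adjoint T \o T) (real_complex R (s ^+ 2)) * (s `^ p)%:E))%E.

Definition schatten (p : R) : set (H -> H) :=
  [set T | compact_operator T /\ (singular_sum p T < +oo)%E].

Definition schatten_norm (p : R) T : R := fine (singular_sum p T) `^ p^-1.

Record is_orthonormal_basis E : Prop := IsOrthonormalBasis {
  onb_dot : forall v w, E v -> E w -> dp v w = (v == w)%:R;
  onb_total : forall w, (forall v, E v -> dp w v = 0) -> w = 0 }.

(* The common value of the unordered sums over all orthonormal bases. *)
Definition trace T : R[i] :=
  get [set t : R[i]^o | forall E, is_orthonormal_basis E ->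
    partial_sum (fun v : E => dp (T (set_val v)) (set_val v) : R[i]^o)
      @ totally --> t].

End Operators.

Section Projective.
Variables (R : realType) (G : topologicalZmodType).
Variables (H : completeNormedModType R[i]) (dp : {dot H for @Num.conj R[i]}).
Implicit Types (m : G -> G -> R[i]) (U : G -> H -> H).

Record is_projective_rep m U : Prop := IsProjectiveRep {
  rep_multiplier : forall x y, `|m x y| = 1;
  rep_unitary : forall x, is_unitary dp (U x);
  rep_strongly_continuous : forall v, continuous (fun x => U x v);
  rep_mul : forall x y, U x \o U y = m x y *: U (x + y);
  rep_one : U 0 = id }.

Definition irreducible_rep U := forall V : set H,
  V 0 -> (forall a v w, V v -> V w -> V (a *: v + w)) -> closed V ->
  (forall x v, V v -> V (U x v)) ->
  V = [set 0] \/ V = setT.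

Definition commutator m (x y : G) : R[i] := m x y / m y x.

Definition heisenberg m := exists s : G -> dual R G,
  (forall x y, s x y = commutator m x y) /\ is_top_iso s.

Definition square_integrable (muG : {measure set (borelType G) -> \bar R}) U :=
  exists v w : H, [/\ v != 0, w != 0 & cL2 muG (fun x => dp (U x v) w)].

Definition integrable_rep (muG : {measure set (borelType G) -> \bar R}) U :=
  exists v : H, v != 0 /\ cL1 muG (fun x => dp (U x v) v).

(* U_xi := U_x for xi = sigma(x, .) *)
Definition dual_rep m U (xi : dual R G) : H -> H :=
  U (xget 0 [set x | forall y, xi y = commutator m x y]).

Definition fourier1 m U (T : H -> H) (xi : dual R G) : R[i] :=
  trace dp (T \o adjoint dp (dual_rep m U xi)).

Section Fourier.
Variable mu : {measure set (borelType (dual R G)) -> \bar R}.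

(* F represents the quantum Fourier transform on S_2(H): it is the extension of
   fourier1 to a unitary operator S_2(H) -> L^2, given by representatives of
   almost everywhere classes.  Existence of such an F expresses that mu has the
   normalization of the Plancherel theorem. *)
Record is_quantum_fourier m U (F : (H -> H) -> borelType (dual R G) -> R[i]) :
    Prop := IsQuantumFourier {
  qf_trace_class : forall T, schatten dp 1 T ->
    ae_eq_fun mu (F T) (fourier1 m U T);
  qf_L2 : forall T, schatten dp 2 T -> cL2 mu (F T);
  qf_linear : forall a T1 T2, schatten dp 2 T1 -> schatten dp 2 T2 ->
    ae_eq_fun mu (F (a *: T1 + T2)) (a *: (F T1 : _ -> R[i]^o) + F T2);
  qf_isometry : forall T, schatten dp 2 T ->
    cL2norm mu (F T) = schatten_norm dp 2 T;
  qf_injective : forall T1 T2, schatten dp 2 T1 -> schatten dp 2 T2 ->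
    ae_eq_fun mu (F T1) (F T2) -> T1 = T2;
  qf_surjective : forall f, cL2 mu f ->
    exists T, schatten dp 2 T /\ ae_eq_fun mu (F T) f }.

Variable F : (H -> H) -> borelType (dual R G) -> R[i].

(* For f in L^2 the set below is a singleton, F being unitary. *)
Definition fourier_inv (f : borelType (dual R G) -> R[i]) : H -> H :=
  get [set T : H -> H | schatten dp 2 T /\ ae_eq_fun mu (F T) f].

Variable gamma : borelType (dual R G) -> R.

Definition sobolev_integral (T : H -> H) : \bar R :=
  (\int[mu]_xi
    ((1 + gamma xi ^+ 2) ^+ 2 * Normc.normc (F T xi) ^+ 2)%:E)%E.

Definition sobolev2 : set (H -> H) :=
  [set T | schatten dp 2 T /\ (sobolev_integral T < +oo)%E].

Definition sobolev2_norm (T : H -> H) : R :=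
  Num.sqrt (fine (sobolev_integral T)).

Definition poisson_op (T : H -> H) : H -> H :=
  fourier_inv (fun xi => real_complex R (1 + gamma xi ^+ 2) * F T xi).

End Fourier.
End Projective.

(* Main.v *)
Require Import Defs.
From mathcomp Require Import all_boot all_order all_algebra.
From mathcomp Require Import all_classical all_reals all_analysis.
From mathcomp Require Import measurable_realfun complex.
Import Order.TTheory GRing.Theory Num.Theory.
Import numFieldNormedType.Exports.
Local Open Scope classical_set_scope.
Local Open Scope ring_scope.

(* Under the Fourier transform F the operator becomes multiplication by
   w = 1 + gamma ^ 2, and F maps the Sobolev space onto the f in L^2 with
   w f in L^2.  Since w >= 1, multiplication by w is a bijection from this set
   onto L^2, with inverse f |-> w^-1 f, and the Sobolev norm of T is the L^2
   norm of w F(T). *)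

Set Implicit Arguments.
Unset Strict Implicit.

(** Squaring removes the square root from the modulus, so measurability and scaling become
    polynomial statements about real and imaginary parts. *)
Lemma sqr_normc (R : realType) (z : R[i]) :
  Normc.normc z ^+ 2 = complex.Re z ^+ 2 + complex.Im z ^+ 2.
Proof. by case: z => a b /=; rewrite sqr_sqrtr// addr_ge0 ?sqr_ge0. Qed.

Lemma sqr_normcZ (R : realType) (a : R) (z : R[i]) :
  Normc.normc (real_complex R a * z) ^+ 2 = a ^+ 2 * Normc.normc z ^+ 2.
Proof.
rewrite !sqr_normc; case: z => x y /=.
by rewrite !mul0r subr0 addr0 !exprMn mulrDr.
Qed.

Section ComplexL2.
Variables (R : realType) (d : measure_display) (X : measurableType d).
Variable mu : {measure set X -> \bar R}.
Implicit Types (f g : X -> R[i]) (a : X -> R).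

Lemma measurable_cfunZ a f : measurable_fun setT a -> measurable_cfun f ->
  measurable_cfun (fun x => real_complex R (a x) * f x).
Proof.
move=> ma [mr mi]; split.
- apply: (eq_measurable_fun (a \* (@complex.Re R \o f))) => [x _|].
    by rewrite /=; case: (f x) => u v /=; rewrite mul0r subr0.
  exact: measurable_funM.
- apply: (eq_measurable_fun (a \* (@complex.Im R \o f))) => [x _|].
    by rewrite /=; case: (f x) => u v /=; rewrite mul0r addr0.
  exact: measurable_funM.
Qed.

Lemma measurable_sqr_normc f : measurable_cfun f ->
  measurable_fun setT (fun x => (Normc.normc (f x) ^+ 2)%:E).
Proof.
move=> [mr mi]; apply/measurable_EFinP.
under eq_fun do rewrite sqr_normc.
by apply: measurable_funD; exact: measurable_funX.
Qed.

(** Pointwise domination; the case of interest is [a] = [w^-1], which turns the transform of a datum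
    into that of a solution. *)
Lemma cL2_le1Z a f : measurable_fun setT a -> (forall x, a x ^+ 2 <= 1) ->
  cL2 mu f -> cL2 mu (fun x => real_complex R (a x) * f x).
Proof.
move=> ma a1 [mf fi]; split; first exact: measurable_cfunZ.
apply: le_lt_trans fi; apply: ge0_le_integral => //=.
- by move=> x _; rewrite lee_fin sqr_ge0.
- by apply: measurable_sqr_normc; exact: measurable_cfunZ.
- exact: measurable_sqr_normc.
- by move=> x _; rewrite lee_fin sqr_normcZ ler_piMl ?sqr_ge0.
Qed.

(** Transforms are determined only up to null sets; this carries integrability and norms from one
    representative to another. *)
Lemma ae_eq_integral_sqr f g : measurable_cfun f -> measurable_cfun g ->
  ae_eq_fun mu f g ->
  (\int[mu]_x (Normc.normc (f x) ^+ 2)%:E =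
   \int[mu]_x (Normc.normc (g x) ^+ 2)%:E)%E.
Proof.
move=> mf mg fg; apply: ge0_ae_eq_integral => //=.
- exact: measurable_sqr_normc.
- exact: measurable_sqr_normc.
- by move=> x _; rewrite lee_fin sqr_ge0.
- by move=> x _; rewrite lee_fin sqr_ge0.
- by apply: filterS fg => x -> _.
Qed.

Lemma ae_eq_fun_sym f g : ae_eq_fun mu f g -> ae_eq_fun mu g f.
Proof. by apply: filterS => x ->. Qed.

Lemma ae_eq_fun_trans f g h :
  ae_eq_fun mu f g -> ae_eq_fun mu g h -> ae_eq_fun mu f h.
Proof. by apply: filterS2 => x -> ->. Qed.

End ComplexL2.

Section Poisson.
Variables (R : realType) (G : topologicalZmodType).
Variables (H : completeNormedModType R[i]) (dp : {dot H for @Num.conj R[i]}).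
Variables (m : G -> G -> R[i]) (U : G -> H -> H).
Variable mu : {measure set (borelType (dual R G)) -> \bar R}.
Variable F : (H -> H) -> borelType (dual R G) -> R[i].
Hypothesis F_fourier : is_quantum_fourier dp mu m U F.
Variable gamma : borelType (dual R G) -> R.
Hypothesis gamma_measurable : measurable_fun [set: borelType (dual R G)] gamma.

Let w xi : R := 1 + gamma xi ^+ 2.

Let w_ge1 xi : 1 <= w xi.
Proof. by rewrite lerDl sqr_ge0. Qed.

Let w_neq0 xi : real_complex R (w xi) != 0.
Proof. by rewrite fmorph_eq0 gt_eqF// (lt_le_trans ltr01). Qed.

Let w_measurable : measurable_fun setT w.
Proof. by apply: measurable_funD => //; exact: measurable_funX. Qed.

Let wV_measurable : measurable_fun setT (fun xi => (w xi)^-1).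
Proof.
(* Since [w] is nonnegative, its inverse is the real power of exponent -1, and real powers are
   measurable. *)
apply: (eq_measurable_fun (fun xi => w xi `^ (-1))) => [xi _|].
  by rewrite powR_inv1// (le_trans ler01).
exact: (measurableT_comp (measurable_powR (-1)) w_measurable).
Qed.

(** [get] yields a meaningful value only on a nonempty set; surjectivity of [F] onto L^2 supplies an
    element. *)
Lemma fourier_invP f : cL2 mu f ->
  schatten dp 2 (fourier_inv dp mu F f) /\
  ae_eq_fun mu (F (fourier_inv dp mu F f)) f.
Proof.
move=> /(qf_surjective F_fourier) [T TP].
exact: (@getPex _ [set T : H -> H | schatten dp 2 T /\ ae_eq_fun mu (F T) f]
  (ex_intro _ T TP)).
Qed.

Lemma sobolev_integralE T : sobolev_integral mu F gamma T =
  (\int[mu]_xi (Normc.normc (real_complex R (w xi) * F T xi) ^+ 2)%:E)%E.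
Proof. by apply: eq_integral => xi _; rewrite sqr_normcZ. Qed.

(** The two integrals coincide, and measurability of the product comes from that of [w] and [F T].
    Hence on the Sobolev space [poisson_op] inverts the transform at a genuine L^2 function. *)
Lemma sobolev2_cL2 T : schatten dp 2 T ->
  sobolev2 dp mu F gamma T <-> cL2 mu (fun xi => real_complex R (w xi) * F T xi).
Proof.
move=> sT; split=> [[_ h]|[_ h]].
  split; last by rewrite -sobolev_integralE.
  by apply: measurable_cfunZ => //; have [] := qf_L2 F_fourier sT.
by split=> //; rewrite sobolev_integralE.
Qed.

(** This trades the operator equation for a pointwise one, where [w] can be cancelled. The converse
    direction rests on injectivity of [F]. *)
Lemma poisson_opP S T : schatten dp 2 S -> sobolev2 dp mu F gamma T ->
  poisson_op dp mu F gamma T = S <->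
  ae_eq_fun mu (fun xi => real_complex R (w xi) * F T xi) (F S).
Proof.
move=> sS hT; have [sT _] := hT.
have [sP eP] := fourier_invP ((sobolev2_cL2 sT).1 hT).
split=> [<-|e]; first exact: ae_eq_fun_sym.
by apply: (qf_injective F_fourier) => //; apply: ae_eq_fun_trans e.
Qed.

Lemma poisson_op_inj T1 T2 :
  sobolev2 dp mu F gamma T1 -> sobolev2 dp mu F gamma T2 ->
  poisson_op dp mu F gamma T1 = poisson_op dp mu F gamma T2 -> T1 = T2.
Proof.
move=> h1 h2 e; have [s1 _] := h1; have [s2 _] := h2.
have [sP2 _] := fourier_invP ((sobolev2_cL2 s2).1 h2).
(* Both equations are read with the image of [T2] as datum, so the two products with [w] agree
   almost everywhere with the same function. *)
have e1 := (poisson_opP sP2 h1).1 e.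
have e2 := (poisson_opP sP2 h2).1 erefl.
apply: (qf_injective F_fourier) => //.
by apply: filterS2 e1 e2 => xi <- /(mulfI (w_neq0 xi)).
Qed.

Lemma poisson_op_surj S : schatten dp 2 S ->
  exists2 T, sobolev2 dp mu F gamma T & poisson_op dp mu F gamma T = S.
Proof.
move=> sS; have fS := qf_L2 F_fourier sS.
have wV1 xi : (w xi)^-1 ^+ 2 <= 1.
  have w0 : 0 < w xi by rewrite (lt_le_trans ltr01).
  by rewrite exprn_ile1// ?invr_ge0 ?invf_le1// ltW.
(* The solution is the preimage under [F] of [w^-1] times the transform of [S]. *)
have [T [sT eT]] := qf_surjective F_fourier (cL2_le1Z wV_measurable wV1 fS).
have e : ae_eq_fun mu (fun xi => real_complex R (w xi) * F T xi) (F S).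
  by apply: filterS eT => xi ->; rewrite fmorphV/= mulVKf.
have hT : sobolev2 dp mu F gamma T.
  apply/sobolev2_cL2 => //.
  (* Almost everywhere equality with [F S] alone would not give measurability, which is therefore
     derived from [F T]; finiteness of the integral does pass over from [F S]. *)
  have mwT : measurable_cfun (fun xi => real_complex R (w xi) * F T xi).
    by apply: measurable_cfunZ => //; have [] := qf_L2 F_fourier sT.
  by split=> //; rewrite (ae_eq_integral_sqr mwT fS.1 e) fS.2.
by exists T => //; apply/poisson_opP.
Qed.

(** The Sobolev norm of [T] is the L^2 norm of [w] times [F T], hence that of [F S], and Plancherel
    identifies the latter with the Hilbert-Schmidt norm of [S]. *)
Lemma sobolev2_norm_poisson S T : schatten dp 2 S -> sobolev2 dp mu F gamma T ->
  poisson_op dp mu F gamma T = S ->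
  sobolev2_norm mu F gamma T = schatten_norm dp 2 S.
Proof.
move=> sS hT /(poisson_opP sS hT) e.
have [mwT _] := (sobolev2_cL2 hT.1).1 hT.
rewrite -(qf_isometry F_fourier)// /sobolev2_norm /cL2norm sobolev_integralE.
by rewrite (ae_eq_integral_sqr mwT (qf_L2 F_fourier sS).1 e).
Qed.

End Poisson.

Unset Implicit Arguments.
Set Strict Implicit.

Theorem theorem4p1 (R : realType)
  (G : topologicalZmodType)
  (G_hausdorff : hausdorff_space G)
  (G_locally_compact : locally_compact [set: G])
  (H : completeNormedModType R[i]) (dp : {dot H for @Num.conj R[i]})
  (H_norm : hilbert_norm dp) (H_separable : separable H)
  (m : G -> G -> R[i]) (U : G -> H -> H)
  (U_rep : is_projective_rep dp m U)
  (U_irreducible : irreducible_rep U)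
  (m_heisenberg : heisenberg m)
  (m_even : forall x y, m x y = m (- x) (- y))
  (muG : {measure set (borelType G) -> \bar R}) (muG_haar : is_haar muG)
  (U_square_integrable : square_integrable dp muG U)
  (U_integrable : integrable_rep dp muG U)
  (mu : {measure set (borelType (dual R G)) -> \bar R}) (mu_haar : is_haar mu)
  (F : (H -> H) -> borelType (dual R G) -> R[i])
  (F_fourier : is_quantum_fourier dp mu m U F)
  (gamma : borelType (dual R G) -> R)
  (gamma_gt0 : forall xi, 0 < gamma xi)
  (gamma_measurable : measurable_fun [set: borelType (dual R G)] gamma)
  (S : H -> H) (S_schatten : schatten dp 2 S) :
  (exists! T0 : H -> H,
     sobolev2 dp mu F gamma T0 /\ poisson_op dp mu F gamma T0 = S) /\
  (forall T0 : H -> H,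
     sobolev2 dp mu F gamma T0 -> poisson_op dp mu F gamma T0 = S ->
     sobolev2_norm mu F gamma T0 = schatten_norm dp 2 S).
Proof.
split=> [|T0]; last exact: (sobolev2_norm_poisson F_fourier gamma_measurable).
have [T hT e] := poisson_op_surj F_fourier gamma_measurable S_schatten.
exists T; split=> // T' [hT' e'].
by apply: (poisson_op_inj F_fourier gamma_measurable) => //; rewrite e e'.
Qed.
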